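(* Let $u_1(t),u_2(t),\ldots,u_n(t)$ be $n$ wide-sense stationary (WSS) jointly Gaussian processes with expected values $\mu_1(t),\mu_2(t),\ldots,\mu_n(t)$ respectively. Let $\mathbf{u}(t)=[u_1(t)\; u_2(t)\;\ldots\;u_n(t)]^T$, $\boldsymbol{\mu}(t)=[\mu_1(t)\;\mu_2(t)\;\ldots\;\mu_n(t)]^T$ and $\mathbf{u}_0(t)=\mathbf{u}(t)-\boldsymbol{\mu}(t)$. Then, for any piecewise differentiable function $f:\mathbb{R}^n\to\mathbb{R}$, the functional $$\epsilon(\mathbf{N},M)=E\left\{\left[f(\mathbf{u}(t))-\mathbf{N}^T\mathbf{u}_0(t)-M\right]^2\right\},$$ where $\mathbf{N}=[N_1\;N_2\;\ldots\;N_n]^T$ is a constant vector in $\mathbb{R}^n$ and $M\in\mathbb{R}$ is a constant, is minimized by $$\mathbf{N}=E\left[\boldsymbol{\nabla} f(\mathbf{u}(t))\right],\qquad M=E\left[f(\mathbf{u}(t))\right].$$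
   Context: $E$ denotes expectation, and $\boldsymbol{\nabla}f=\left[\frac{\partial f}{\partial u_1}\;\frac{\partial f}{\partial u_2}\;\cdots\;\frac{\partial f}{\partial u_n}\right]^T$ is the gradient of $f$ with respect to its argument $\mathbf{u}=[u_1\;\ldots\;u_n]^T$. The components of $\mathbf{N}$ are called quasilinear gains and $M$ the quasilinear bias.
   Formalization: Piecewise differentiable is taken to mean a continuous f that is locally a selection of finitely many differentiable functions, and f is assumed differentiable at u(t) almost surely with integrable gradient, so that E[∇f(u(t))] exists; without this the claim fails (f = sign; median of (Z,Z,Z)). *)

(* Defs.v *)
From HB Require Import structures.
From mathcomp Require Import all_boot all_order all_algebra.
From mathcomp Require Import all_classical all_reals all_analysis.
Import Order.TTheory GRing.Theory Num.Theory.
Import numFieldNormedType.Exports.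

Set Implicit Arguments.
Unset Strict Implicit.
Unset Printing Implicit Defensive.

Local Open Scope classical_set_scope.
Local Open Scope ring_scope.

(* The B j may be setT, so the product rule for the whole finite family
   contains the product rule for each of its subfamilies. *)
Definition mutually_independent (R : realType) d (T : measurableType d)
    (P : probability T R) k (Z : 'I_k -> {RV P >-> R}) : Prop :=
  forall B : 'I_k -> set R, (forall j, measurable (B j)) ->
    P (\bigcap_(j in [set: 'I_k]) (Z j @^-1` B j)) =
    (\prod_(j < k) P (Z j @^-1` B j))%E.

(* A Gaussian vector is an affine image X = b + A Z of a standard normal
   vector Z.  Singular covariances are allowed.  Taking Z on the probability
   space of X loses no generality: with k the rank of the covariance, A is
   injective and Z is an affine function of X. *)
Definition gaussian_vector (R : realType) d (T : measurableType d)
    (P : probability T R) (I : finType) (X : I -> {RV P >-> R}) : Prop :=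
  exists (k : nat) (Z : 'I_k -> {RV P >-> R}) (b : I -> R) (A : I -> 'I_k -> R),
    [/\ forall j (B : set R), measurable B ->
          distribution P (Z j) B = normal_prob 0 1 B,
        mutually_independent Z
      & {ae P, forall w, forall i, X i w = b i + \sum_(j < k) A i j * Z j w}].

Definition jointly_gaussian (R : realType) d (T : measurableType d)
    (P : probability T R) n (u : 'I_n -> R -> {RV P >-> R}) : Prop :=
  forall (m : nat) (s : 'I_m -> R),
    @gaussian_vector R d T P ('I_n * 'I_m)%type (fun ij => u ij.1 (s ij.2)).

Definition wide_sense_stationary (R : realType) d (T : measurableType d)
    (P : probability T R) (X : R -> {RV P >-> R}) : Prop :=
  [/\ forall t, (X t : T -> R) \in Lfun P 2%:E,
      forall t s, ('E_P[X t] = 'E_P[X s])%E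
    & forall t s h, covariance P (X (t + h)) (X (s + h)) =
                    covariance P (X t) (X s)].

(* Piecewise differentiable in the sense of Scholtes, with differentiable
   instead of C^1 pieces: f is a continuous selection of functions g i, which
   near each point are finitely many and differentiable.  The pieces are the
   sets where f = g i.  Continuity is needed: for a step function the pointwise
   gradient misses the jumps.  So is differentiability of each g i on a whole
   neighbourhood: the Cantor function is continuous, and differentiable on two
   open sets whose union has a null complement. *)
Definition piecewise_differentiable (R : realType) n (f : 'cV[R]_n -> R) : Prop :=
  continuous f /\
  forall x : 'cV[R]_n, exists (k : nat) (g : 'I_k -> 'cV[R]_n -> R),
    \forall y \near x,
      (forall i, differentiable (g i) y) /\ (exists i, f y = g i y).

Definition gradient (R : realType) n (f : 'cV[R]_n -> R) (x : 'cV[R]_n) :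
    'cV[R]_n :=
  \col_i 'D_(delta_mx i 0) f x.

Definition random_col (R : realType) d (T : measurableType d)
    (P : probability T R) n (X : 'I_n -> {RV P >-> R}) (w : T) : 'cV[R]_n :=
  \col_i X i w.

(* 'E_P takes values in \bar R; fine is the identity on finite values. *)
Definition mean (R : realType) d (T : measurableType d)
    (P : probability T R) (X : T -> R) : R := fine ('E_P[X])%E.

Definition mean_col (R : realType) d (T : measurableType d)
    (P : probability T R) n (X : T -> 'cV[R]_n) : 'cV[R]_n :=
  \col_i mean P (fun w => X w i 0).

(* "E[grad f(U)] exists".  The gradient has to exist almost surely in the
   Frechet sense because U may live on a proper affine subspace: for the median
   f of three variables and U = (Z, Z, Z), all the partial derivatives of f
   exist and vanish at U, although f(U) = Z. *)
Definition has_mean_gradient (R : realType) d (T : measurableType d)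
    (P : probability T R) n (f : 'cV[R]_n -> R) (U : T -> 'cV[R]_n) : Prop :=
  {ae P, forall w, differentiable f (U w)} /\
  forall i, P.-integrable [set: T] (fun w => (gradient f (U w) i 0)%:E).

(* Takes values in \bar R; it is +oo when f(U) is not square integrable. *)
Definition quasilinear_error (R : realType) d (T : measurableType d)
    (P : probability T R) n (f : 'cV[R]_n -> R) (U U0 : T -> 'cV[R]_n)
    (N : 'cV[R]_n) (M : R) : \bar R :=
  ('E_P[fun w => ((f (U w) - (N^T *m U0 w) 0 0 - M) ^+ 2)%R])%E.

(* Main.v *)
Require Import Defs.
From mathcomp Require Import all_boot all_order all_algebra.
From mathcomp Require Import all_classical all_reals all_analysis.
From mathcomp Require Import measurable_realfun ring lra.
Import Order.TTheory GRing.Theory Num.Theory.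
Import numFieldNormedType.Exports.

(** By definition of a Gaussian vector, u(t) = b + A Z almost surely, with Z a
    vector of independent standard normal variables and b = mu(t).  A linear
    predictor N^T u0(t) + M is thus a combination of the Z_l and the constant
    function 1, which form an orthonormal system in L2.  If some predictor has
    a finite error then Y = f(u(t)) is in L2, and the error is smallest when
    the predictor has the coefficients E[Y Z_l] of Y along the Z_l, and E[Y]
    along 1 ([least_squares_orthonormal]).  It remains to see that N = E[grad f]
    yields these coefficients: by the chain rule this is Stein's identity
    E[Z_l f(b + A Z)] = E[D_a f(b + A Z)], with a the l-th column of A
    ([stein_gaussian]).

    As Z_l is independent of the other variables, Fubini's theorem reduces
    Stein's identity to the restrictions h of f to lines parallel to a,
    and there it says that the derivative of h(x) phi(x), for the normal density
    phi, has integral zero ([stein_lebesgue]).  The point to prove is that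
    h phi is the integral of its derivative.  The derivative is integrable, but
    neither continuous nor locally bounded, so the fundamental theorem of
    calculus is needed in a Lebesgue form.  A continuous selection of finitely
    many differentiable functions has bounded difference quotients near each
    point ([differentiable_selection_lipschitz]) and is differentiable outside
    a countable set, since two pieces that cross with different slopes do so at
    an isolated point ([differentiable_selection_derivable]).  Such a function
    is the integral of its derivative whenever the latter is integrable
    ([FTC_pointwise_lipschitz]).

    The hypotheses give Frechet differentiability of f only almost surely along
    u(t), and measurability of the gradient only as a function on the sample
    space.  To apply Fubini's theorem on the product of the line with the space
    of the other variables, derivatives are therefore replaced by the limit
    superior of difference quotients with steps 1 / (m + 1)
    ([upper_derivative]), which is measurable because f is continuous. *)

Set Implicit Arguments.
Unset Strict Implicit.
Unset Printing Implicit Defensive.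

Local Open Scope classical_set_scope.
Local Open Scope ring_scope.

Local Notation leb := (@lebesgue_measure _).
Local Notation gamma := (normal_prob 0 1).

(** * The fundamental theorem of calculus for pointwise Lipschitz functions *)

Lemma invn_lt (R : realType) (e : R) :
  0 < e -> exists m : nat, m.+1%:R^-1 < e.
Proof.
move=> e0; exists (Num.bound e^-1); rewrite invf_plt ?posrE ?ltr0n//.
rewrite (lt_le_trans (archi_boundP _)) ?invr_ge0 ?(ltW e0)//.
by rewrite ler_nat.
Qed.

(** The local bounds add up along [a, b] because Phi is monotone.  The proof
    takes the supremum of the points up to which the bound holds: the local
    bound at this supremum, on its left, puts it among these points, and on its
    right, leads beyond it. *)
Lemma local_growth_bound (R : realType) (H Phi : R -> R) :
  {homo Phi : x y / x <= y} ->
  (forall x, \forall y \near x, `|H y - H x| <= `|Phi y - Phi x|) ->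
  forall a b, a <= b -> `|H b - H a| <= Phi b - Phi a.
Proof.
move=> ndPhi loc a b ab.
pose S := [set x | a <= x <= b /\ `|H x - H a| <= Phi x - Phi a].
have Sa : S a by split; rewrite ?lexx// !subrr normr0.
have hsS : has_sup S by split; [exists a|exists b => x [/andP[]]].
set s := sup S.
have as_ : a <= s by exact: ub_le_sup hsS.2 _ Sa.
have sb : s <= b by apply: ge_sup; [exists a|move=> x [/andP[]]].
have extend x y : S x -> x <= y <= b ->
    `|H y - H x| <= `|Phi y - Phi x| -> S y.
  move=> [/andP[ax xb] Hx] /andP[xy yb] Hxy.
  split; first by rewrite (le_trans ax).
  rewrite (ger0_norm (_ : 0 <= Phi y - Phi x)) ?subr_ge0 ?ndPhi// in Hxy.
  have -> : H y - H a = (H y - H x) + (H x - H a) by ring.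
  have -> : Phi y - Phi a = (Phi y - Phi x) + (Phi x - Phi a) by ring.
  by rewrite (le_trans (ler_normD _ _))// lerD.
have /nbhs_ballP[e /= e0 He] := loc s.
(* S has points close enough to s for the local bound at s to apply. *)
have Ss : S s.
  have [x Sx sex] := sup_adherent e0 hsS.
  have xs : x <= s by exact: ub_le_sup hsS.2 _ Sx.
  apply: (extend x) => //; first by rewrite xs.
  rewrite distrC [leRHS]distrC; apply: He.
  by rewrite /ball/= ger0_norm ?subr_ge0// ltrBlDr addrC -ltrBlDr.
have [_] : S b; last by [].
have [bs|bs] := leP b s; first by have <- : s = b by apply/le_anti/andP.
(* If s < b, the bound extends beyond s, against the choice of s. *)
pose y := Num.min b (s + e / 2).
have sy : s < y by rewrite /y lt_min bs ltrDl divr_gt0.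
have Sy : S y.
  apply: (extend s) => //; first by rewrite (ltW sy)/= /y ge_min lexx.
  apply: He; rewrite /ball/= distrC ger0_norm ?subr_ge0 ?(ltW sy)//.
  rewrite ltrBlDl /y gt_min; apply/orP; right; rewrite ltrD2l.
  by rewrite ltr_pdivrMr// ltr_pMr// ltr1n.
by have := ub_le_sup hsS.2 Sy; rewrite leNgt sy.
Qed.

Lemma null_set_open_cover (R : realType) (E : set R) (eps : R) :
  measurable E -> leb E = 0%E -> 0 < eps ->
  exists U : set R,
    [/\ open U, measurable U, E `<=` U & (leb U < eps%:E)%E].
Proof.
move=> mE E0 e0.
have Eoo : (leb E < +oo)%E by rewrite E0 ltry.
have [U [oU EU UE]] := lebesgue_regularity_outer mE Eoo e0.
have mU : measurable U := open_measurable oU.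
exists U; split => //.
have UEE : U = (U `\` E) `|` E by rewrite setUC setDUK.
rewrite [X in leb X]UEE.
apply: le_lt_trans (measureU2 leb _ mE) _; first exact: measurableD.
by rewrite [X in (_ + X)%E](E0 : leb E = 0%E) adde0.
Qed.

(** Cover E by open sets O_m of measure at most eps / 2^(m+1), and let Psi x be
    the sum over m of the measures of the parts of O_m left of x.  Near a point
    of E the first K of these sets contain an interval, where Psi grows with
    slope at least K. *)
Lemma null_set_steep_function (R : realType) (E : set R) (eps : R) :
  measurable E -> leb E = 0%E -> 0 < eps ->
  exists Psi : R -> R, [/\ {homo Psi : x y / x <= y},
    forall x, 0 <= Psi x <= eps &
    forall x (C : R), E x ->
      \forall y \near x, C * `|y - x| <= `|Psi y - Psi x| ].
Proof.
move=> mE E0 e0.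
pose d m := eps / (2 ^ m.+1)%:R.
have d0 m : 0 < d m by rewrite divr_gt0// ltr0n expn_gt0.
have [ O HO] := choice (fun m => null_set_open_cover mE E0 (d0 m)).
have mO m : measurable (O m) by case: (HO m).
(* M has density sum_m 1_(O m) with respect to Lebesgue measure. *)
pose M : {measure set (measurableTypeR R) -> \bar R} :=
  mseries (fun m => mrestr leb (mO m)) 0.
have MT : (M setT <= eps%:E)%E.
  apply: le_trans (epsilon_trick0 xpredT (ltW e0)).
  apply: lee_nneseries => k _; first by move=> _; exact: measure_ge0.
  by rewrite /= /mrestr setTI ltW//; case: (HO k).
have Mfin A : measurable A -> M A \is a fin_num.
  move=> mA; rewrite ge0_fin_numE ?measure_ge0//.
  rewrite (le_lt_trans (le_measure _ _ _ (@subsetT _ A))) ?inE//.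
  by rewrite (le_lt_trans MT)// ltry.
pose Psi x := fine (M `]-oo, x]%classic).
have PsiD x y : x <= y -> Psi y - Psi x = fine (M `]x, y]%classic).
  move=> xy; rewrite /Psi.
  have -> : `]-oo, y]%classic = `]-oo, x] `|` `]x, y].
    by rewrite -itv_bndbnd_setU.
  rewrite measureU//; first by rewrite fineD ?Mfin//; ring.
  apply/seteqP; split => // z []/=; rewrite !in_itv/= => zx /andP[xz _].
  by have := lt_le_trans xz zx; rewrite ltxx.
have steep x y K : x <= y -> (forall m, (m < K)%N -> `]x, y] `<=` O m) ->
    K%:R * (y - x) <= Psi y - Psi x.
  move=> xy xyO; rewrite PsiD// -lee_fin fineK ?Mfin//.
  apply: le_trans (@nneseries_lim_ge _ _ xpredT 0 K _); last first.
    by move=> k _ _; exact: measure_ge0.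
  under eq_big_nat => k /andP[_ kK].
    rewrite /= /mrestr setIidl; last exact: xyO.
    over.
  rewrite lebesgue_measure_itv/= lte_fin.
  case: ltP => [xy'|yx]; last first.
    have -> : y = x by apply/le_anti/andP.
    by rewrite subrr mulr0 sume_ge0.
  by rewrite -EFinB sumEFin lee_fin sumr_const_nat subn0 mulr_natl.
have ndPsi : {homo Psi : x y / x <= y}.
  move=> x y xy; rewrite -subr_ge0; apply: le_trans (steep x y 0%N xy _) => //.
  by rewrite mul0r.
exists Psi; split => //.
  move=> x; rewrite fine_ge0 ?measure_ge0//= -lee_fin fineK ?Mfin//.
  by rewrite (le_trans _ MT)// le_measure ?inE.
move=> x C Ex.
have [K CK] : exists K : nat, C <= K%:R.
  exists (Num.bound `|C|); rewrite (le_trans (ler_norm C))// ltW//.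
  exact: archi_boundP.
have : \forall y \near x, forall m : 'I_K, O m y.
  apply: (@filter_forall R 'I_K (fun m => O m) (nbhs x) _) => m.
  case: (HO m) => oO _ EO _.
  by apply: open_nbhs_nbhs; split => //; exact: EO.
move=> /nbhs_ballP[e /= e0' He]; apply/nbhs_ballP; exists e => //= y xey.
have seg a b : ball x e a -> ball x e b -> a <= b ->
    C * (b - a) <= Psi b - Psi a.
  move=> xa xb ab; apply: le_trans (steep a b K ab _).
    by rewrite ler_wpM2r// subr_ge0.
  move=> m mK z /=; rewrite in_itv/= => /andP[az zb].
  apply: (He z _ (Ordinal mK)).
  move: xa xb; rewrite /ball/= !ltr_distlC => /andP[xa _] /andP[_ xb].
  by rewrite (lt_trans xa az) (le_lt_trans zb xb).
have [xy|/ltW yx] := leP x y.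
  by rewrite !ger0_norm ?subr_ge0 ?ndPsi// seg//; exact: ballxx.
rewrite distrC [leRHS]distrC !ger0_norm ?subr_ge0 ?ndPsi// seg//.
exact: ballxx.
Qed.

(** Integrate |g| over an open neighbourhood of E which is so small that this
    integral is at most eps. *)
Lemma null_set_integral_growth (R : realType) (E : set R) (g : R -> R)
    (eps : R) :
  let F x := \int[leb]_(t in `]-oo, x]) g t in
  measurable E -> leb E = 0%E -> 0 < eps ->
  leb.-integrable setT (EFin \o g) ->
  exists Psi : R -> R, [/\ {homo Psi : x y / x <= y},
    forall x, 0 <= Psi x <= eps &
    forall x, E x -> \forall y \near x, `|F y - F x| <= `|Psi y - Psi x| ].
Proof.
move=> F mE E0 e0 ig.
have [d [d0 Hd]] := integral_normr_continuous ig e0.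
have [ O [oO mO EO Od]] := null_set_open_cover mE E0 d0.
pose h := (fun t => `|g t|) \_ O.
have ih : leb.-integrable setT (EFin \o h).
  have : leb.-integrable O (EFin \o (fun t => `|g t|)).
    by apply: integrableS (integrable_norm ig).
  by rewrite integrable_mkcond//= restrict_EFin.
have iS (f : R -> R) A : measurable A -> leb.-integrable setT (EFin \o f) ->
    leb.-integrable A (EFin \o f).
  by move=> mA; apply: integrableS.
have h0 x : 0 <= h x by rewrite /h patchE; case: ifP.
pose Psi x := \int[leb]_(t in `]-oo, x]) h t.
have PsiD x y : x <= y -> Psi y - Psi x = \int[leb]_(t in `]x, y]) h t.
  by move=> xy; rewrite /Psi Rintegral_itvB ?bnd_simp//; apply: iS.
have FD x y : x <= y -> F y - F x = \int[leb]_(t in `]x, y]) g t.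
  by move=> xy; rewrite /F Rintegral_itvB ?bnd_simp//; apply: iS.
exists Psi; split.
- by move=> x y xy; rewrite -subr_ge0 PsiD// Rintegral_ge0.
- move=> x; rewrite Rintegral_ge0//=; apply: le_trans (ltW (Hd O mO Od)).
  rewrite [leRHS]Rintegral_mkcond -/h /Psi Rintegral_mkcond.
  apply: le_Rintegral => //.
    have : leb.-integrable `]-oo, x]%classic (EFin \o h) by exact: iS.
    by rewrite [X in X -> _]integrable_mkcond//= restrict_EFin.
  by move=> y _; rewrite patchE; case: ifP.
move=> x Ex.
have /nbhs_ballP[e /= e0' He] : \forall y \near x, O y.
  by apply: open_nbhs_nbhs; split => //; exact: EO.
have seg a b : ball x e a -> ball x e b -> a <= b ->
    `|F b - F a| <= Psi b - Psi a.
  move=> xa xb ab; rewrite FD// PsiD//.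
  apply: le_trans (le_normr_Rintegral _ _) _ => //; first exact: iS.
  apply: le_Rintegral => //; [|exact: iS|].
    exact: iS (integrable_norm ig).
  move=> z /=; rewrite in_itv/= => /andP[az zb].
  rewrite /h patchE mem_set//; apply: He.
  move: xa xb; rewrite /ball/= !ltr_distlC => /andP[xa _] /andP[_ xb].
  by rewrite (lt_trans xa az) (le_lt_trans zb xb).
apply/nbhs_ballP; exists e => //= y xey.
have [xy|/ltW yx] := leP x y.
  by rewrite (le_trans _ (ler_norm _))// seg//; exact: ballxx.
rewrite distrC [leRHS]distrC (le_trans _ (ler_norm _))// seg//; exact: ballxx.
Qed.

(** The definition of the derivative as a first-order expansion, without the
    division by y - x, hence valid at y = x as well. *)
Lemma is_derive_estimate (R : realType) (f : R -> R) (x df eps : R) :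
  is_derive x 1 f df -> 0 < eps ->
  \forall y \near x, `|f y - f x - df * (y - x)| <= eps * `|y - x|.
Proof.
move=> [fx dfE] e0.
have : h^-1 *: (f (h *: 1 + x) - f x) @[h --> 0^'] --> df.
  by rewrite -dfE; exact: fx.
move=> /cvgrPdist_le/(_ _ e0)/nbhs_ballP[e /= e0' He].
apply/nbhs_ballP; exists e => //= y xy.
have [->|yx] := eqVneq y x; first by rewrite !subrr mulr0 subr0 !normr0 mulr0.
have yx0 : y - x != 0 by rewrite subr_eq0.
have -> : f y - f x - df * (y - x) =
    ((y - x)^-1 * (f y - f x) - df) * (y - x) by field.
rewrite normrM ler_wpM2r// distrC.
have := He (y - x); rewrite /ball/= sub0r normrN -(distrC x) => /(_ xy yx0).
by rewrite scaler1 subrK.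
Qed.

(** Let F be the indefinite integral of g.  By Lebesgue's differentiation
    theorem G - F has derivative zero outside a null set E.  A function of
    slope e controls its growth near the points outside E; near those of E the
    growth of G is at most linear, so it is controlled by
    [null_set_steep_function], and that of F by [null_set_integral_growth].
    The sum of the three controls has an arbitrarily small increment over
    [a, b], so [local_growth_bound] shows that G - F is constant. *)
Lemma FTC_pointwise_lipschitz (R : realType) (G g : R -> R) :
  (forall x : R, exists C : R,
    \forall y \near x, `|G y - G x| <= C * `|y - x|) ->
  {ae leb, forall x : R, is_derive x 1 G (g x)} ->
  leb.-integrable setT (EFin \o g) ->
  forall a b, a <= b -> G b - G a = \int[leb]_(t in `]a, b]) g t.
Proof.
move=> lipG dG ig a b ab.
have iS A : measurable A -> leb.-integrable A (EFin \o g).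
  by move=> mA; apply: integrableS ig.
pose F x := \int[leb]_(t in `]-oo, x]) g t.
have dF : {ae leb, forall x : R, derivable F x 1 /\ F^`()%classic x = g x}.
  apply: FTC1Ny; first by move=> y; exact: iS.
  by apply: open_integrable_locally => //; exact: openT.
pose H x := G x - F x.
have dH : {ae leb, forall x : R, is_derive x 1 H 0}.
  have FF : Filter (nbhs (almost_everywhere leb)) :=
    ae_filter_ringOfSetsType leb.
  apply: filterS2 dG dF => x dGx [dFx F'x].
  rewrite -(subrr (g x)) -{2}F'x derive1E; apply: is_deriveB.
  exact: derivableP.
have [E [mE E0 /= sE]] := dH.
suff : `|H b - H a| <= 0.
  rewrite normr_le0 /H => /eqP Hab.
  have -> : G b - G a = F b - F a by lra.
  by rewrite /F Rintegral_itvB ?bnd_simp//; exact: iS.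
apply/ler_addgt0Pr => eps eps0; rewrite add0r.
(* The three controls have increments e * (b - a), e and e. *)
pose e := eps / (b - a + 2).
have ba2 : 0 < b - a + 2 by rewrite ltr_wpDl ?subr_ge0.
have e0 : 0 < e by rewrite divr_gt0.
have [P1 [nd1 P1e HP1]] := null_set_steep_function mE E0 e0.
have [P2 [nd2 P2e HP2]] := null_set_integral_growth mE E0 e0 ig.
pose Phi x := e * x + P1 x + P2 x.
have PhiD x y :
    `|Phi y - Phi x| = e * `|y - x| + `|P1 y - P1 x| + `|P2 y - P2 x|.
  wlog xy : x y / x <= y.
    move=> wl; have [/wl//|/ltW/wl] := leP x y.
    rewrite distrC => ->.
    by rewrite !(distrC y) (distrC (P1 y)) (distrC (P2 y)).
  rewrite (ger0_norm (_ : 0 <= y - x)) ?subr_ge0//.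
  rewrite (ger0_norm (_ : 0 <= P1 y - P1 x)) ?subr_ge0 ?nd1//.
  rewrite (ger0_norm (_ : 0 <= P2 y - P2 x)) ?subr_ge0 ?nd2//.
  have -> : Phi y - Phi x = e * (y - x) + (P1 y - P1 x) + (P2 y - P2 x).
    by rewrite /Phi; ring.
  rewrite ger0_norm//; apply: addr_ge0; last by rewrite subr_ge0 nd2.
  by apply: addr_ge0; rewrite ?subr_ge0 ?nd1// mulr_ge0 ?subr_ge0// ltW.
have ndPhi : {homo Phi : x y / x <= y}.
  by move=> x y xy; rewrite /Phi !lerD ?nd1 ?nd2// ler_wpM2l// ltW.
have HPhi : forall x, \forall y \near x, `|H y - H x| <= `|Phi y - Phi x|.
  move=> x; have [Ex|nEx] := pselect (E x).
    have [C HC] := lipG x.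
    near=> y; rewrite PhiD.
    have -> : H y - H x = (G y - G x) - (F y - F x) by rewrite /H; ring.
    rewrite (le_trans (ler_normB _ _))// lerD//; last by near: y; exact: HP2.
    apply: (@le_trans _ _ (C * `|y - x|)); first by near: y; exact: HC.
    apply: (@le_trans _ _ `|P1 y - P1 x|); last by rewrite lerDr mulr_ge0// ltW.
    by near: y; exact: HP1.
  have dHx : is_derive x 1 H 0 by apply: contra_notP nEx => /sE.
  have := is_derive_estimate dHx e0; apply: filterS => y.
  rewrite mul0r subr0 PhiD => /le_trans; apply.
  by rewrite -addrA lerDl addr_ge0.
apply: le_trans (local_growth_bound ndPhi HPhi ab) _.
rewrite (le_trans (ler_norm _))// PhiD (ger0_norm (_ : 0 <= b - a)) ?subr_ge0//.
have -> : eps = e * (b - a) + e + e.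
  by rewrite /e; field; rewrite gt_eqF.
have := P1e a; have := P1e b; have := P2e a; have := P2e b.
move=> /andP[? ?] /andP[? ?] /andP[? ?] /andP[? ?].
rewrite !lerD// ger0_norm ?subr_ge0 ?nd1 ?nd2//; lra.
Unshelve. all: by end_near. Qed.

(** * Continuous selections of differentiable functions *)

(** The notion of [piecewise_differentiable], over any normed module, so that
    it applies to the restrictions of a function to lines. *)
Definition differentiable_selection (R : realType) (V : normedModType R)
    (f : V -> R) : Prop :=
  continuous f /\
  forall x : V, exists (k : nat) (g : 'I_k -> V -> R),
    \forall y \near x,
      (forall i, differentiable (g i) y) /\ (exists i, f y = g i y).

Lemma differentiable_selection_differentiable (R : realType)
    (V : normedModType R) (f : V -> R) :
  (forall x, differentiable f x) -> differentiable_selection f.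
Proof.
move=> df; split=> [x|x]; first exact: differentiable_continuous.
by exists 1%N, (fun=> f); apply: nearW => y; split => //; exists ord0.
Qed.

(** A piece that differs from f at x differs from f near x, by continuity; so
    near x only the pieces through (x, f x) are selected. *)
Lemma near_active_piece (R : realType) (V : normedModType R) (f : V -> R) k
    (g : 'I_k -> V -> R) (x : V) :
  {for x, continuous f} ->
  (\forall y \near x,
     (forall i, differentiable (g i) y) /\ (exists i, f y = g i y)) ->
  \forall y \near x, exists2 i, f x = g i x & f y = g i y.
Proof.
move=> cf pf; have [dg _] := nbhs_singleton pf.
have act : \forall y \near x, forall i, f y = g i y -> f x = g i x.
  apply: (@filter_forall V 'I_k
    (fun i y => f y = g i y -> f x = g i x) (nbhs x) _).
  move=> i; have [->|fgx] := eqVneq (f x) (g i x); first exact: nearW.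
  have cfg : {for x, continuous (f \- g i)}.
    by apply: cvgB => //; exact: differentiable_continuous.
  have := cvgr_neq0 _ cfg; rewrite /= subr_eq0 => /(_ _ fgx).
  by apply: filterS => y /[swap] ->; rewrite subrr eqxx.
apply: filterS2 pf act => y [_ [i fy]] ay.
by exists i => //; exact: ay.
Qed.

Lemma is_deriveP (R : realType) (f : R -> R) (x df : R) :
  (forall eps, 0 < eps ->
    \forall y \near x, `|f y - f x - df * (y - x)| <= eps * `|y - x|) ->
  is_derive x 1 f df.
Proof.
move=> H.
suff dfE : h^-1 *: (f (h *: 1 + x) - f x) @[h --> 0^'] --> df.
  by split; [apply/cvg_ex; exists df|exact/cvg_lim].
apply/cvgrPdist_le => e e0; have /nbhs_ballP[d /= d0 Hd] := H _ e0.
apply/nbhs_ballP; exists d => //= h; rewrite /ball/= sub0r normrN => hd h0.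
have := Hd (h + x); rewrite /ball/= opprD addrCA addrN addr0 normrN => /(_ hd).
rewrite addrK scaler1 => Hh.
have -> : df - h^-1 *: (f (h + x) - f x) = - (f (h + x) - f x - df * h) / h.
  by rewrite /GRing.scale/=; field.
by rewrite normrM normrN normfV ler_pdivrMr ?normr_gt0.
Qed.

(** Near x the increment of f is the increment of a piece through (x, f x), and
    there are finitely many pieces, each with bounded difference quotients. *)
Lemma differentiable_selection_lipschitz (R : realType) (f : R -> R) (x : R) :
  differentiable_selection f ->
  exists C : R, \forall y \near x, `|f y - f x| <= C * `|y - x|.
Proof.
move=> [cf pf]; have [k [g pg]] := pf x.
have [dg _] := nbhs_singleton pg.
pose C i := `|'D_1 (g i) x| + 1.
exists (\sum_i C i).
have gC : \forall y \near x, forall i, `|g i y - g i x| <= C i * `|y - x|.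
  apply: (@filter_forall R 'I_k
    (fun i y => `|g i y - g i x| <= C i * `|y - x|) (nbhs x) _).
  move=> i; have /derivableP/is_derive_estimate : derivable (g i) x (1 : R).
    exact: diff_derivable.
  move=> /(_ _ ltr01); apply: filterS => y; rewrite mul1r => Hy.
  rewrite -(subrK ('D_1 (g i) x * (y - x)) (g i y - g i x)).
  rewrite (le_trans (ler_normD _ _))// /C mulrDl mul1r addrC lerD//.
  by rewrite normrM.
apply: filterS2 gC (near_active_piece (cf x) pg) => y gy [i -> ->].
rewrite (le_trans (gy i))// ler_wpM2r// (bigD1 i)//= lerDl sumr_ge0//.
by move=> j _; rewrite /C addr_ge0.
Qed.

(** Such zeros are isolated: near one of them, h has no other zero.  Those that
    are alone at distance 1 / (m + 1) are told apart by the integer part of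
    x (m + 1). *)
Lemma countable_transverse_zeros (R : realType) (h : R -> R) :
  countable [set x : R | [/\ h x = 0, derivable h x 1 & 'D_1 h x != 0]].
Proof.
pose S (m : nat) := [set x : R | h x = 0 /\
  forall y, `|y - x| < m.+1%:R^-1 -> y != x -> h y != 0].
apply: (@sub_countable _ _ _ (\bigcup_m S m)); last first.
  apply: bigcup_countable => // m _.
  apply/countable_injP; exists (fun x => pickle (Num.floor (x * m.+1%:R))).
  move=> x y; rewrite !inE => -[hx Sx] [hy _] /(pcan_inj pickleK) xy.
  apply/eqP; apply: contraT; rewrite eq_sym => yx.
  suff : h y != 0 by rewrite hy eqxx.
  apply: Sx => //.
  have m0 : (0 : R) < m.+1%:R by rewrite ltr0n.
  rewrite -(ltr_pM2r m0) mulVf ?gt_eqF// -(gtr0_norm m0) -normrM mulrBl.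
  have /andP[] := floor_itv (x * m.+1%:R).
  have /andP[] := floor_itv (y * m.+1%:R).
  rewrite xy intrD ltr_norml => *; lra.
apply: subset_card_le => x [hx dh h'x].
have e0 : 0 < `|'D_1 h x| / 2 by rewrite divr_gt0// normr_gt0.
have /nbhs_ballP[d /= d0 Hd] := is_derive_estimate (derivableP dh) e0.
have [m md] := invn_lt d0.
exists m => //; split => // y ym yx; apply/eqP => hy.
have := Hd y; rewrite /ball/= distrC (lt_trans ym md) => /(_ isT).
rewrite hx hy subr0 sub0r normrN normrM => H.
have yx0 : 0 < `|y - x| by rewrite normr_gt0 subr_eq0.
move: H; rewrite ler_pM2r// => H.
have : 0 < `|'D_1 h x| by rewrite normr_gt0.
lra.
Qed.

(** If all the pieces through (x, f x) have the same slope at x, this slope is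
    the derivative of f.  Otherwise x is a transverse zero of the difference of
    two pieces.  Countably many intervals with rational data, on each of which
    the pieces are fixed, cover the line; so only countably many points x are
    of the second kind. *)
Lemma differentiable_selection_derivable (R : realType) (f : R -> R) :
  differentiable_selection f ->
  {ae leb, forall x : R, derivable f x 1}.
Proof.
move=> [cf pf].
suff cB : countable [set x : R | ~ derivable f x 1].
  exists [set x : R | ~ derivable f x 1]; split => //.
    exact: countable_measurable.
  exact: countable_lebesgue_measure0.
pose J (p : rat * nat) : set R := ball (ratr p.1 : R) p.2.+1%:R^-1.
pose nice p := exists (k : nat) (g : 'I_k -> R -> R), forall y, J p y ->
  (forall i, differentiable (g i) y) /\ (exists i, f y = g i y).
apply: (@sub_countable _ _ _
  (\bigcup_(p in nice) (J p `&` [set x | ~ derivable f x 1]))).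
  apply: subset_card_le => x dfx.
  have [k [g /nbhs_ballP[d /= d0 Hd]]] := pf x.
  have [m md] := invn_lt (divr_gt0 d0 (ltr0n R 2)).
  have m0 : (0 : R) < m.+1%:R^-1 by rewrite invr_gt0 ltr0n.
  have [q] := @rat_in_itvoo R x (x + m.+1%:R^-1) (ltr_pwDr m0 (lexx x)).
  rewrite in_itv/= => /andP[xq qx].
  have Jx : J (q, m) x.
    by rewrite /J /ball/= ger0_norm ?subr_ge0 ?(ltW xq)// ltrBlDl.
  exists (q, m) => //; exists k, g => y Jy; apply: Hd.
  move: Jx Jy; rewrite /J /ball/= => Jx Jy.
  rewrite distrC in Jx; have := ler_normD (x - ratr q) (ratr q - y).
  rewrite addrA subrK => /le_lt_trans; apply.
  by rewrite [ltRHS]splitr ltrD// (lt_trans _ md).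
apply: bigcup_countable; first exact: countableP.
move=> p [k [g gP]].
pose S (ij : 'I_k * 'I_k) := [set x : R | [/\ (g ij.1 \- g ij.2) x = 0,
  derivable (g ij.1 \- g ij.2) x 1 & 'D_1 (g ij.1 \- g ij.2) x != 0]].
apply: (@sub_countable _ _ _ (\bigcup_ij S ij)); last first.
  by apply: bigcup_countable => // ij _; exact: countable_transverse_zeros.
apply: subset_card_le => x [Jx dfx]; apply: contrapT => nS; apply: dfx.
have pg : \forall y \near x,
    (forall i, differentiable (g i) y) /\ (exists i, f y = g i y).
  apply: filterS gP _; apply: open_nbhs_nbhs; split => //.
  exact: ball_open.
have [dg [i0 fi0]] := gP _ Jx.
have dg1 i : derivable (g i) x 1 by exact: diff_derivable.
have same i : f x = g i x -> 'D_1 (g i) x = 'D_1 (g i0) x.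
  move=> fi; apply: contrapT => /eqP; rewrite -subr_eq0 => ne; apply: nS.
  exists (i, i0) => //=; split; first by rewrite /= -fi -fi0 subrr.
    exact: derivableB.
  by rewrite deriveB.
suff [] : is_derive x 1 f ('D_1 (g i0) x) by [].
apply: is_deriveP => eps eps0.
have est : \forall y \near x, forall i,
    `|g i y - g i x - 'D_1 (g i) x * (y - x)| <= eps * `|y - x|.
  apply: (@filter_forall R 'I_k (fun i y =>
    `|g i y - g i x - 'D_1 (g i) x * (y - x)| <= eps * `|y - x|) (nbhs x) _).
  by move=> i; apply: is_derive_estimate => //; exact: derivableP.
apply: filterS2 est (near_active_piece (cf x) pg) => y ey [i fxi ->].
by rewrite -(same i fxi) fxi.
Qed.

(** * Stein's identity for the standard normal law *)

Lemma integrable_small_value (R : realType) (G : R -> R) (D : set R) (eps : R) :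
  measurable D -> leb D = +oo%E ->
  leb.-integrable setT (EFin \o G) -> 0 < eps ->
  exists2 x, D x & `|G x| <= eps.
Proof.
move=> mD Doo iG e0; apply: contrapT => no.
have big x : D x -> eps <= `|G x|.
  move=> Dx; apply: ltW; rewrite ltNge; apply/negP => le.
  by apply: no; exists x.
have /integrableP[mG] : leb.-integrable D (EFin \o G) by apply: integrableS iG.
apply/negP; rewrite -leNgt.
(* If |G| exceeded eps on D, its integral over D would be infinite. *)
have -> : +oo%E = (\int[leb]_(x in D) eps%:E)%E.
  by rewrite integral_cst//= [X in (_ * X)%E](Doo) gt0_muley// lte_fin.
apply: ge0_le_integral => //.
- by move=> x _; rewrite lee_fin ltW.
- by apply/measurable_EFinP/measurableT_comp => //; exact/measurable_EFinP.
Qed.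

Lemma integrable_small_tail (R : realType) (g : R -> R) (eps : R) :
  leb.-integrable setT (EFin \o g) -> 0 < eps ->
  exists n : nat, forall a b : R, a < - n%:R -> n%:R < b ->
    `|\int[leb]_x g x - \int[leb]_(x in `]a, b]) g x| <= eps.
Proof.
move=> ig e0.
have iS A : measurable A -> leb.-integrable A (EFin \o g).
  by move=> mA; apply: integrableS ig.
pose F (n : nat) := `[- n%:R, n%:R]%classic : set R.
have FT : \bigcup_n F n = setT.
  rewrite -subTset => x _; exists (Num.bound `|x|) => //=.
  by rewrite /F/= in_itv/= -ler_norml ltW// archi_boundP.
have ndF : {homo F : n m / (n <= m)%N >-> (n <= m)%O}.
  move=> n m nm; apply/subsetPset => x; rewrite /F/= !in_itv/= -!ler_norml.
  by move=> /le_trans; apply; rewrite ler_nat.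
have mF n : measurable (F n) by exact: measurable_itv.
have ing : leb.-integrable setT (EFin \o (fun x => `|g x|)).
  exact: integrable_norm.
have iSn A : measurable A -> leb.-integrable A (EFin \o (fun x => `|g x|)).
  by move=> mA; apply: integrableS ing.
have : \int[leb]_(x in F n) `|g x| @[n --> \oo] --> \int[leb]_x `|g x|.
  apply: fine_cvg; rewrite fineK; last exact: integrable_fin_num.
  rewrite -FT; apply: ge0_nondecreasing_set_cvg_integral => // n.
  by case/integrableP : (iSn _ (mF n)).
move=> /cvgrPdist_le/(_ _ e0)[n _ /(_ n (leqnn n))/= Hn].
exists n => a b an nb.
have setC_Rint (f : R -> R) A :
    measurable A -> leb.-integrable setT (EFin \o f) ->
    \int[leb]_x f x - \int[leb]_(x in A) f x = \int[leb]_(x in ~` A) f x.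
  move=> mA iff; rewrite -(setUv A) Rintegral_setU ?setUv//.
  - by rewrite addrC addKr.
  - exact: measurableC.
  - by apply/disj_setPS; rewrite setICr.
rewrite setC_Rint//.
apply: le_trans (le_normr_Rintegral _ _) _.
- exact: measurableC.
- exact/iS/measurableC.
apply: le_trans Hn; rewrite setC_Rint; [|exact: mF|exact: ing].
apply: (le_trans _ (ler_norm _)).
rewrite Rintegral_mkcond [leRHS]Rintegral_mkcond; apply: le_Rintegral => //.
- have := iSn _ (measurableC (measurable_itv `]a, b])).
  rewrite [X in X -> _]integrable_mkcond//= ?restrict_EFin//.
  exact: measurableC.
- have := iSn _ (measurableC (mF n)).
  rewrite [X in X -> _]integrable_mkcond//= ?restrict_EFin//.
  exact: (measurableC (mF n)).
move=> x _; rewrite !patchE; case: ifPn => [|_]; last first.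
  by case: ifP => _; [exact: normr_ge0|exact: lexx].
rewrite !inE => xab; rewrite mem_set// => Fx; apply: xab; move: Fx.
rewrite /F/= in_itv/= => /andP[nx xn] /=.
by rewrite in_itv/= (lt_le_trans an nx) (le_trans xn (ltW nb)).
Qed.

(** Both G b - G a and the part of the integral of g outside ]a, b] are small
    for suitable a near -oo and b near +oo: the former because an integrable
    function takes small values on every set of infinite measure, the latter
    because the tails of an integrable function are small. *)
Lemma integral_derivative_eq0 (R : realType) (G g : R -> R) :
  differentiable_selection G ->
  {ae leb, forall x : R, is_derive x 1 G (g x)} ->
  leb.-integrable setT (EFin \o G) -> leb.-integrable setT (EFin \o g) ->
  \int[leb]_x g x = 0.
Proof.
move=> sG dG iG ig; apply/eqP; rewrite -normr_le0.
apply/ler_addgt0Pr => eps eps0.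
rewrite add0r; have e0 : 0 < eps / 3 by rewrite divr_gt0.
have [n Hn] := integrable_small_tail ig e0.
have [a + Ga] : exists2 a, `]-oo, (- n%:R)[%classic a & `|G a| <= eps / 3.
  apply: integrable_small_value => //.
  by rewrite lebesgue_measure_itv/= ?ltNyr ?ltry.
have [b + Gb] : exists2 b, `]n%:R, +oo[%classic b & `|G b| <= eps / 3.
  apply: integrable_small_value => //.
  by rewrite lebesgue_measure_itv/= ?ltNyr ?ltry.
rewrite /= !in_itv/= andbT => nb an.
have FTC : G b - G a = \int[leb]_(t in `]a, b]) g t.
  apply: FTC_pointwise_lipschitz => //.
  - by move=> x; exact: differentiable_selection_lipschitz.
  - by have : (0 : R) <= n%:R := ler0n _ _; lra.
have := Hn _ _ an nb; rewrite -FTC => H.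
rewrite -(subrK (G b - G a) (\int[leb]_x g x)).
rewrite (le_trans (ler_normD _ _))//.
have := ler_normB (G b) (G a); lra.
Qed.

Lemma differentiable_selectionM (R : realType) (f q : R -> R) :
  differentiable_selection f -> (forall x, differentiable q x) ->
  differentiable_selection (fun x => f x * q x).
Proof.
move=> [cf pf] dq; split.
  move=> x; apply: continuousM; first exact: cf.
  exact: differentiable_continuous.
move=> x; have [k [g pg]] := pf x.
exists k, (fun i y => g i y * q y); apply: filterS pg => y [dg [i fy]].
split; last by exists i; rewrite fy.
by move=> j; exact: differentiableM.
Qed.

Lemma is_derive_std_normal_pdf (R : realType) (x : R) :
  is_derive x 1 (normal_pdf 0 1) (- x * normal_pdf 0 1 x).
Proof.
rewrite normal_pdfE ?oner_eq0//.
have nE y : normal_fun 0 1 y = expR (- (y * y) / 2) :> R.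
  by rewrite /normal_fun subr0 expr1n expr2.
under eq_fun do rewrite nE.
by apply: is_derive_eq; rewrite nE /GRing.scale/=; field.
Qed.

(** Since phi' x = - x * phi x, the function D x * phi x - x * h x * phi x is
    the derivative of h * phi almost everywhere. *)
Lemma stein_lebesgue (R : realType) (h D : R -> R) :
  let phi := normal_pdf 0 1 in
  differentiable_selection h ->
  (forall x, derivable h x 1 -> D x = 'D_1 h x) ->
  leb.-integrable setT (EFin \o (fun x => h x * phi x)) ->
  leb.-integrable setT (EFin \o (fun x => x * h x * phi x)) ->
  leb.-integrable setT (EFin \o (fun x => D x * phi x)) ->
  \int[leb]_x (x * h x * phi x) = \int[leb]_x (D x * phi x).
Proof.
move=> phi sh Dh ih ixh iD; apply/eqP; rewrite eq_sym -subr_eq0 -RintegralB//.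
apply/eqP; have dphi (x : R) := is_derive_std_normal_pdf x.
apply: (@integral_derivative_eq0 _ (fun x => h x * phi x)) => //.
- apply: differentiable_selectionM => // x; apply/derivable1_diffP.
  by case: (dphi x).
- have FF : Filter (nbhs (almost_everywhere leb)) :=
    ae_filter_ringOfSetsType leb.
  apply: filterS (differentiable_selection_derivable sh) => x dhx.
  have dh : is_derive x 1 h (D x) by rewrite Dh//; exact: derivableP.
  by apply: is_derive_eq; rewrite /GRing.scale/= /phi; ring.
- by apply: eq_integrable (integrableB _ iD ixh).
Qed.

Lemma ge0_integral_normal_prob (R : realType) (m s : R) (f : R -> \bar R) :
  measurable_fun setT f -> (forall x, 0 <= f x)%E ->
  (\int[normal_prob m s]_x f x = \int[leb]_x (f x * (normal_pdf m s x)%:E))%E.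
Proof.
move=> mf f0; have dom := normal_prob_dominates m s.
rewrite -(Radon_Nikodym_SigmaFinite.change_of_variables dom)//=.
have if_ := Radon_Nikodym_SigmaFinite.f_integrable dom.
apply: ae_eq_integral => //.
- apply: emeasurable_funM => //; exact: (measurable_int leb).
- apply: emeasurable_funM => //; apply/measurable_EFinP.
  exact: measurable_normal_pdf.
- apply: ae_eqe_mul2l => /=; apply: integral_ae_eq => //.
  + by apply/measurable_EFinP; exact: measurable_normal_pdf.
  + move=> E _ mE; rewrite -Radon_Nikodym_SigmaFinite.f_integral//.
Qed.

Lemma integral_normal_prob (R : realType) (m s : R) (f : R -> \bar R) :
  measurable_fun setT f ->
  (\int[normal_prob m s]_x f x = \int[leb]_x (f x * (normal_pdf m s x)%:E))%E.
Proof.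
move=> mf; rewrite integralE [RHS]integralE.
rewrite !ge0_integral_normal_prob//;
  [|exact: measurable_funeneg|exact: measurable_funepos].
have pdf0 x : (0 <= (normal_pdf m s x)%:E)%E by rewrite lee_fin normal_pdf_ge0.
congr (_ - _)%E; apply: eq_integral => x _.
- by rewrite !funeposE maxe_pMl// mul0e.
- by rewrite !funenegE maxe_pMl// mul0e mulNe.
Qed.

Lemma normal_prob_integrable_pdf (R : realType) (m s : R) (f : R -> R) :
  (normal_prob m s).-integrable setT (EFin \o f) ->
  leb.-integrable setT (EFin \o (fun x => f x * normal_pdf m s x)).
Proof.
move=> iff; have /integrableP[mf foo] := iff; apply/integrableP; split.
  apply/measurable_EFinP/measurable_funM; first exact/measurable_EFinP.
  exact: measurable_normal_pdf.
have mnf : measurable_fun setT (fun x => `|(f x)%:E|%E).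
  exact: measurableT_comp.
have := integral_normal_prob m s mnf => /=.
under [X in _ = X -> _]eq_integral => x _.
  rewrite -EFinM -{1}(ger0_norm (normal_pdf_ge0 m s x)) -normrM.
  over.
by move=> <-.
Qed.

Lemma stein_std_normal (R : realType) (h D : R -> R) :
  differentiable_selection h ->
  (forall x, derivable h x 1 -> D x = 'D_1 h x) ->
  gamma.-integrable setT (EFin \o h) ->
  gamma.-integrable setT (EFin \o (fun x => x * h x)) ->
  gamma.-integrable setT (EFin \o D) ->
  (\int[gamma]_x (x * h x)%:E = \int[gamma]_x (D x)%:E)%E.
Proof.
move=> sh Dh ih ixh iD.
rewrite !integral_normal_prob//;
  [|by case/integrableP : iD|by case/integrableP : ixh].
under eq_integral do rewrite -EFinM.
under [RHS]eq_integral do rewrite -EFinM.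
have jh := normal_prob_integrable_pdf ih.
have jxh := normal_prob_integrable_pdf ixh.
have jD := normal_prob_integrable_pdf iD.
have stein := stein_lebesgue sh Dh jh jxh jD.
have fin (f : R -> R) : leb.-integrable setT (EFin \o f) ->
    (\int[leb]_x (f x)%:E)%E = (\int[leb]_x f x)%:E.
  by move=> jf; rewrite fineK//; exact: integrable_fin_num.
by rewrite !fin// stein.
Qed.

(** * Measurability and directional derivatives on column vectors *)

(** Continuity turns the preimage of an open ray into an open set of columns,
    which is a countable union of boxes with rational data, and the preimages
    of boxes are finite intersections of preimages by the coordinates. *)
Lemma measurable_continuous_col (R : realType) d (T : measurableType d) n
    (f : 'cV[R]_n -> R) (V : T -> 'cV[R]_n) :
  continuous f -> (forall i, measurable_fun setT (fun w => V w i 0)) ->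
  measurable_fun setT (f \o V).
Proof.
move=> cf mV.
apply: (measurability _ (RGenOInfty.measurableE R)) => _ [_ [a ->] <-].
rewrite setTI; set A := `]a, +oo[%classic.
have oA : open (f @^-1` A).
  by apply: open_comp => [x _|]; [exact: cf|exact: interval_open].
pose box (p : 'cV[rat]_n * nat) : set 'cV[R]_n :=
  ball (\col_i (ratr (p.1 i 0) : R)) p.2.+1%:R^-1.
pose good (p : 'cV[rat]_n * nat) := box p `<=` f @^-1` A.
have -> : (f \o V) @^-1` A =
    \bigcup_p (if `[< good p >] then V @^-1` box p else set0).
  apply/seteqP; split=> [w Aw|w [p _]]; last by case: asboolP => // gp /gp.
  have /nbhs_ballP[e /= e0 He] : nbhs (V w) (f @^-1` A).
    by apply: open_nbhs_nbhs.
  have [m me] := invn_lt (divr_gt0 e0 (ltr0n R 2)).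
  have m0 : (0 : R) < m.+1%:R^-1 by rewrite invr_gt0 ltr0n.
  have qex i : exists q : rat, ratr q \in `](V w i 0), (V w i 0 + m.+1%:R^-1)[.
    by apply: rat_in_itvoo; rewrite ltrDl.
  have [q Hq] := choice qex.
  have bw : box (\col_i q i, m) (V w).
    split => //= i j; rewrite !mxE /ball/= (ord1 j).
    have := Hq i; rewrite in_itv/= => /andP[h1 h2].
    by rewrite ger0_norm ?subr_ge0 ?(ltW h1)// ltrBlDl.
  exists (\col_i q i, m) => //; rewrite ifT//.
  apply/asboolP => x bx; apply: He; split => // i j.
  have [_ /(_ i j)] := bw; have [_ /(_ i j)] := bx.
  rewrite /ball/= !mxE => h1 h2; rewrite distrC in h2.
  have := ler_normD (V w i j - ratr (q i)) (ratr (q i) - x i j).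
  rewrite addrA subrK => /le_lt_trans; apply.
  by rewrite [ltRHS]splitr ltrD// (lt_trans _ me).
apply: countable_bigcupT_measurable => [|p]; first exact: countableP.
case: ifP => // _.
have -> : V @^-1` box p = \bigcap_(i in [set: 'I_n])
    ((fun w => V w i 0) @^-1` ball (ratr (p.1 i 0) : R) p.2.+1%:R^-1).
  apply/seteqP; split=> [w [_ bw] i _|w bw].
    by have := bw i 0; rewrite mxE.
  by split; rewrite ?invr_gt0 ?ltr0n// => i j; rewrite mxE (ord1 j); exact: bw.
apply: fin_bigcap_measurable => // i _.
by rewrite -[X in measurable X]setTI; apply: mV => //; exact: measurable_ball.
Qed.

(** A substitute for 'D_a f that is measurable for every continuous f, since it
    is a limit superior of a sequence of continuous functions, and equal to
    'D_a f where the latter exists.  At the points where the limit superior is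
    infinite, [fine] gives 0. *)
Definition upper_derivative (R : realType) (V : normedModType R) (f : V -> R)
    (a x : V) : R :=
  fine (limn_esup (fun m =>
    (m.+1%:R * (f (m.+1%:R^-1 *: a + x) - f x))%:E)).

Lemma upper_derivativeE (R : realType) (V : normedModType R) (f : V -> R)
    (a x : V) :
  derivable f x a -> upper_derivative f a x = 'D_a f x.
Proof.
move=> dfa.
have c0 : (m.+1%:R^-1 : R) @[m --> \oo] --> 0^'.
  move=> A /= /(@cvg_harmonic R _) [N _ HN]; exists N => // m /HN /=; apply.
  by rewrite gt_eqF// harmonic_gt0.
have : (m.+1%:R * (f (m.+1%:R^-1 *: a + x) - f x) : R) @[m --> \oo] -->
    'D_a f x.
  have -> : (fun m => m.+1%:R * (f (m.+1%:R^-1 *: a + x) - f x) : R) =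
      (fun h => h^-1 *: (f (h *: a + x) - f x)) \o (fun m => m.+1%:R^-1).
    by apply/funext => m /=; rewrite invrK.
  exact: cvg_comp c0 dfa.
move=> H; have /cvg_limn_einf_sup[_ supE] :
    (m.+1%:R * (f (m.+1%:R^-1 *: a + x) - f x))%:E @[m --> \oo] -->
    ('D_a f x)%:E.
  by apply: cvg_EFin => //; exact: nearW.
by rewrite /upper_derivative supE.
Qed.

Lemma upper_derivative_affine (R : realType) (V : normedModType R) (f : V -> R)
    (a x : V) (c : R) :
  (forall t : R, f (t *: a + x) - f x = t * c) -> upper_derivative f a x = c.
Proof.
move=> fc; rewrite /upper_derivative.
under eq_fun do rewrite fc mulrA divff ?pnatr_eq0// mul1r.
have cc : (fun=> c%:E) @ \oo --> c%:E by exact: cvg_cst.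
by have [_ ->] := cvg_limn_einf_sup cc.
Qed.

Lemma measurable_upper_derivative_col (R : realType) d (T : measurableType d) n
    (f : 'cV[R]_n -> R) (a : 'cV[R]_n) (V : T -> 'cV[R]_n) :
  continuous f -> (forall i, measurable_fun setT (fun w => V w i 0)) ->
  measurable_fun setT (fun w => upper_derivative f a (V w)).
Proof.
move=> cf mV; apply: measurableT_comp => //.
apply: measurable_fun_limn_esup => m.
apply/measurable_EFinP; apply: measurable_funM => //.
apply: measurable_funB; last exact: (measurable_continuous_col cf mV).
apply: (measurable_continuous_col cf) => i.
by under eq_fun do rewrite mxE; exact: measurable_funD.
Qed.

Lemma differentiable_selection_line (R : realType) (V : normedModType R)
    (f : V -> R) (a x : V) :
  differentiable_selection f ->
  differentiable_selection (fun t : R => f (t *: a + x)).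
Proof.
move=> [cf pf].
have dl (t : R) : differentiable (fun t : R => t *: a + x) t.
  apply: differentiableD => //; apply: differentiableZl.
have cl (t : R) : {for t, continuous (fun t : R => t *: a + x)}.
  exact: differentiable_continuous.
split=> [t|t]; first by apply: continuous_comp; [exact: cl|exact: cf].
have [k [g pg]] := pf (t *: a + x).
exists k, (fun i t => g i (t *: a + x)).
have ct : \forall s \near t, (forall i, differentiable (g i) (s *: a + x)) /\
    (exists i, f (s *: a + x) = g i (s *: a + x)).
  exact: (cl t _ pg).
apply: filterS ct => s [dg [i fs]]; split; last by exists i.
by move=> j; apply: differentiable_comp.
Qed.

Lemma upper_derivative_line (R : realType) (V : normedModType R) (f : V -> R)
    (a x : V) (t : R) :
  derivable (fun t : R => f (t *: a + x)) t 1 ->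
  upper_derivative f a (t *: a + x) = 'D_1 (fun t : R => f (t *: a + x)) t.
Proof.
(* The difference quotients on the line are those of f in direction a. *)
have qE : (fun h : R =>
      h^-1 *: (f ((h *: (1 : R) + t) *: a + x) - f (t *: a + x))) =
    (fun h : R => h^-1 *: (f (h *: a + (t *: a + x)) - f (t *: a + x))).
  by apply/funext => h; rewrite scalerDl addrA scaler1.
by rewrite /derivable /derive qE => /upper_derivativeE.
Qed.

(** * Independence and Stein's identity for Gaussian vectors *)

(** Independence of X and W says that the law of (X, W) is the product of their
    laws. *)
Lemma independent_pair_prod (R : realType) d d1 d2 (T : measurableType d)
    (T1 : measurableType d1) (T2 : measurableType d2) (P : probability T R)
    (m1 : probability T1 R) (m2 : probability T2 R)
    (X : T -> T1) (W : T -> T2) (f : T1 * T2 -> \bar R) :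
  measurable_fun setT X -> measurable_fun setT W ->
  (forall A B, measurable A -> measurable B ->
    P (X @^-1` A `&` W @^-1` B) = m1 A * m2 B)%E ->
  measurable_fun setT f ->
  P.-integrable setT (fun w => f (X w, W w)) ->
  (m1 \x m2)%E.-integrable setT f /\
  (\int[P]_w f (X w, W w) = \int[m1 \x m2]_z f z)%E.
Proof.
move=> mX mW ind mf intf.
have mXW : measurable_fun setT (fun w => (X w, W w)).
  exact: measurable_fun_pair.
pose XW : {mfun T >-> (T1 * T2)%type} :=
  MeasurableFun.Pack (MeasurableFun.Class
    (isMeasurableFun.Build _ _ _ _ _ mXW)).
have eqm A : measurable A -> (m1 \x m2)%E A = distribution P XW A.
  by move=> mA; apply: product_measure_unique.
have iD : (distribution P XW).-integrable setT f.
  exact: (@integrable_pushforward _ _ _ _ R XW).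
split.
  case/integrableP : iD => _ foo; apply/integrableP; split => //.
  by rewrite (eq_measure_integral (distribution P XW)) => // A mA _; exact: eqm.
rewrite (eq_measure_integral (distribution P XW)) => [|A mA _]; last exact: eqm.
by rewrite (@integral_pushforward _ _ _ _ R XW).
Qed.

(** For fixed A, both sides are finite measures in B, so it suffices to compare
    them on the generating pi-system G. *)
Lemma independent_sigma (R : realType) d (T : measurableType d)
    (P : probability T R) (G : set (set T)) (A : set T) :
  G `<=` measurable -> G setT -> setI_closed G -> measurable A ->
  (forall B, G B -> P (A `&` B) = P A * P B)%E ->
  forall B, <<s G >> B -> (P (A `&` B) = P A * P B)%E.
Proof.
move=> mG GT GI mA ind B sB.
have PA0 : 0 <= fine (P A) by rewrite fine_ge0.
(* The measure scaling takes a nonnegative real, hence the [fine]. *)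
have scE C : mscale (NngNum PA0) P C = (P A * P C)%E.
  by rewrite /mscale/= fineK// fin_num_measure.
have rE C : mrestr P mA C = P (A `&` C) by rewrite /mrestr setIC.
rewrite -rE -scE.
apply: (@g_sigma_algebra_measure_unique _ _ _ _ mG (fun=> setT) (fun=> GT) _
  (mrestr P mA) (mscale (NngNum PA0) P) GI) => //.
- by apply/seteqP; split => // x _; exists 0%N.
- by move=> C GC; rewrite [LHS]rE [RHS]scE ind.
- move=> _; apply: (@le_lt_trans _ _ 1%E); last exact: ltry.
  by rewrite [leLHS]rE probability_le1// setIT.
Qed.

Section independent_normals.
Context (R : realType) d (T : measurableType d) (P : probability T R) (k : nat).
Variables (Z : 'I_k -> {RV P >-> R}) (j : 'I_k).
Hypothesis lawZ : forall j (B : set R), measurable B ->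
  distribution P (Z j) B = gamma B.
Hypothesis indZ : mutually_independent Z.

Let cyl (B : 'I_k -> set R) : set T :=
  \bigcap_(l in [set: 'I_k]) (Z l @^-1` B l).

(** These sets are a pi-system that generates the information carried by the
    variables other than [Z j]; the condition [B j = setT] makes [Z j] free. *)
Definition other_cylinders : set (set T) :=
  [set C | exists B : 'I_k -> set R,
    [/\ forall l, measurable (B l), B j = setT & C = cyl B]].

Lemma other_cylinders_measurable : other_cylinders `<=` measurable.
Proof.
move=> _ [B [mB _ ->]]; apply: fin_bigcap_measurable => // l _.
by rewrite -[X in measurable X]setTI; exact: measurable_funPT.
Qed.

Lemma other_cylinders_setT : other_cylinders setT.
Proof.
exists (fun=> setT); split=> //; apply/seteqP; split => // w _ l _.
Qed.

Lemma other_cylinders_setI : setI_closed other_cylinders.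
Proof.
move=> _ _ [B [mB Bj ->]] [C [mC Cj ->]]; exists (fun l => B l `&` C l); split.
- by move=> l; exact: measurableI.
- by rewrite Bj Cj setIT.
- by rewrite /cyl -bigcapI.
Qed.

Lemma other_cylinders_independent (A : set R) (C : set T) : measurable A ->
  <<s other_cylinders >> C -> (P (Z j @^-1` A `&` C) = gamma A * P C)%E.
Proof.
move=> mA sC; rewrite -(lawZ j mA).
apply: (independent_sigma other_cylinders_measurable other_cylinders_setT
  other_cylinders_setI) => //.
  by rewrite -[X in measurable X]setTI; exact: measurable_funPT.
move=> _ [B [mB Bj ->]].
(* Intersecting with the event that Z j is in A changes the base of the cylinder
   at j from setT to A. *)
pose B' l := if l == j then A else B l.
have -> : Z j @^-1` A `&` cyl B = cyl B'.
  apply/seteqP; split=> [w [wA wB] l _|w wB'].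
    by rewrite /B' /=; case: eqVneq => [->|_] //; exact: wB.
  split; first by have := wB' j I; rewrite /B' eqxx.
  move=> l _; have := wB' l I; rewrite /B' /=; case: eqVneq => // -> _.
  by rewrite Bj.
rewrite indZ; last by move=> l; rewrite /B'; case: ifP.
rewrite indZ// (bigD1 j)//= [in RHS](bigD1 j)//= /B' eqxx Bj preimage_setT.
rewrite probability_setT mul1e; congr (_ * _)%E.
by apply: eq_bigr => l /negbTE ->.
Qed.

Lemma measurable_other l : l != j ->
  measurable_fun [set: g_sigma_algebraType other_cylinders] (Z l : T -> R).
Proof.
move=> lj _ B mB; rewrite setTI; apply: sub_sigma_algebra.
exists (fun i => if i == l then B else setT); split.
- by move=> i; case: ifP.
- by rewrite eq_sym (negbTE lj).
- apply/seteqP; split => [w wB i _|w /(_ l I)]; last by rewrite eqxx.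
  by rewrite /=; case: eqP => // ->.
Qed.

(** Write V = x a_j + W with x = Z j, where W only depends on the other
    variables.  The pair of Z j and the identity of T has a product law, if the
    second copy of T carries the sigma-algebra generated by the other variables;
    this copy stands for the space of the values of these.  For almost every
    value of W, Stein's identity on the line applies to f restricted to the
    line of direction a_j through W. *)
Lemma stein_gaussian n (f : 'cV[R]_n -> R) (b : 'cV[R]_n)
    (a : 'I_k -> 'cV[R]_n) :
  let V w := b + \sum_l Z l w *: a l in
  differentiable_selection f ->
  P.-integrable setT (fun w => (f (V w))%:E) ->
  P.-integrable setT (fun w => (Z j w * f (V w))%:E) ->
  P.-integrable setT (fun w => (upper_derivative f (a j) (V w))%:E) ->
  \int[P]_w (Z j w * f (V w)) = \int[P]_w upper_derivative f (a j) (V w).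
Proof.
move=> V sf iV iZV iD; congr fine.
(* S is T with the sigma-algebra generated by the other variables. *)
pose S := g_sigma_algebraType other_cylinders.
pose W (w : S) := b + \sum_(l | l != j) Z l w *: a l.
have VE w : V w = Z j w *: a j + W w.
  by rewrite /V /W (bigD1 j)//= addrCA.
pose p (z : measurableTypeR R * S) := z.1 *: a j + W z.2.
have mp i : measurable_fun setT (fun z => p z i 0).
  under eq_fun do rewrite /p /W !mxE.
  apply: measurable_funD.
    by apply: measurable_funM => //; exact: measurable_fst.
  apply: measurable_funD => //.
  have -> : (fun z : measurableTypeR R * S =>
      (\sum_(l | l != j) Z l z.2 *: a l) i 0) =
      (fun z => \sum_l if l != j then Z l z.2 * a l i 0 else 0).
    apply/funext => z; rewrite summxE [LHS]big_mkcond/=.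
    by apply: eq_bigr => l _; rewrite mxE.
  apply: measurable_sum => l; case: (boolP (l != j)) => [lj|_ //].
  apply: measurable_funM => //.
  exact: (measurableT_comp (measurable_other lj) measurable_snd).
have mf0 := measurable_continuous_col sf.1 mp.
have mD := measurable_upper_derivative_col (a j) sf.1 mp.
have mid : measurable_fun setT (id : T -> S).
  move=> _ B sB; rewrite setTI; move: B sB; apply: smallest_sub.
    exact: sigma_algebra_measurable.
  exact: other_cylinders_measurable.
pose idS : {mfun T >-> S} :=
  MeasurableFun.Pack (MeasurableFun.Class
    (isMeasurableFun.Build _ _ _ _ _ mid)).
have mZ : measurable_fun setT (Z j) by exact: measurable_funPT.
have ind A B : measurable A -> measurable B ->
    P (Z j @^-1` A `&` (id : T -> S) @^-1` B) =
    (gamma A * distribution P idS B)%E.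
  by move=> mA mB; exact: other_cylinders_independent.
have fubini (h : measurableTypeR R * S -> R) : measurable_fun setT h ->
    P.-integrable setT (fun w => (h (Z j w, w))%:E) ->
    (gamma \x distribution P idS)%E.-integrable setT (EFin \o h) /\
    (\int[P]_w (h (Z j w, w))%:E =
     \int[gamma \x distribution P idS]_z (h z)%:E)%E.
  move=> mh ih.
  have mEh : measurable_fun setT (EFin \o h) by exact/measurable_EFinP.
  exact: (@independent_pair_prod R _ _ _ T (measurableTypeR R) S P
    gamma (distribution P idS) (Z j) id (EFin \o h) mZ mid ind mEh ih).
have Vp : V = (fun w => p (Z j w, w)) by apply/funext => w; rewrite VE.
rewrite Vp in iV iZV iD *.
have mZf : measurable_fun setT (fun z : measurableTypeR R * S => z.1 * f (p z)).
  by apply: measurable_funM => //; exact: measurable_fst.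
have [jV _] := fubini (fun z => f (p z)) mf0 iV.
have [jZ ->] := fubini (fun z => z.1 * f (p z)) mZf iZV.
have [jD ->] := fubini (fun z => upper_derivative f (a j) (p z)) mD iD.
rewrite -(integral21_prod_meas1 jZ) -(integral21_prod_meas1 jD).
apply: ae_eq_integral => //.
- exact: measurable_fubini_G jZ.
- exact: measurable_fubini_G jD.
have FF : Filter (nbhs (almost_everywhere (distribution P idS))).
  exact: ae_filter_ringOfSetsType.
apply: filterS3 (ae_integrable2 jV) (ae_integrable2 jZ) (ae_integrable2 jD).
move=> y iy1 iy2 iy3 _.
apply: (@stein_std_normal R (fun x => f (x *: a j + W y))
  (fun x => upper_derivative f (a j) (x *: a j + W y))) => //.
- exact: differentiable_selection_line.
- by move=> x; exact: upper_derivative_line.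
Qed.

End independent_normals.

(** * Orthonormal least squares in L2 *)

Section square_integrable.
Context (R : realType) d (T : measurableType d) (P : probability T R).
Implicit Types f g : T -> R.

Definition square_integrable f : Prop :=
  measurable_fun setT f /\ P.-integrable setT (EFin \o (fun w => f w ^+ 2)).

(** By the inequality of arithmetic and geometric means, |f g| is at most
    f^2 + g^2. *)
Lemma square_integrableM f g : square_integrable f -> square_integrable g ->
  P.-integrable setT (EFin \o (fun w => f w * g w)).
Proof.
move=> [mf if2] [mg ig2].
apply: (le_integrable measurableT _ _ (integrableD measurableT if2 ig2)).
  by apply/measurable_EFinP; exact: measurable_funM.
move=> w _; rewrite /= lee_fin normrM [leRHS]ger0_norm ?addr_ge0 ?sqr_ge0//.
rewrite -(real_normK (num_real (f w))) -(real_normK (num_real (g w))).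
have := sqr_ge0 (`|f w| - `|g w|).
have := mulr_ge0 (normr_ge0 (f w)) (normr_ge0 (g w)).
lra.
Qed.

Lemma square_integrable_cst c : square_integrable (fun=> c).
Proof.
split; first exact: measurable_cst.
exact: (finite_measure_integrable_cst P (c ^+ 2)).
Qed.

Lemma square_integrable_integrable f : square_integrable f ->
  P.-integrable setT (EFin \o f).
Proof.
move=> sf; have := square_integrableM sf (square_integrable_cst 1).
by apply: eq_integrable => // w _ /=; rewrite mulr1.
Qed.

Lemma square_integrableD f g : square_integrable f -> square_integrable g ->
  square_integrable (fun w => f w + g w).
Proof.
move=> sf sg; have ifg := square_integrableM sf sg.
case: sf sg => [mf if2] [mg ig2]; split; first exact: measurable_funD.
have := integrableD measurableT if2
  (integrableD measurableT (integrableZl measurableT 2 ifg) ig2).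
apply: eq_integrable => // w _ /=; congr EFin; ring.
Qed.

Lemma square_integrableZ c f : square_integrable f ->
  square_integrable (fun w => c * f w).
Proof.
move=> [mf if2]; split; first exact: measurable_funM.
have := integrableZl measurableT (c ^+ 2) if2.
by apply: eq_integrable => // w _ /=; rewrite exprMn.
Qed.

Lemma square_integrable_sum (I : Type) (s : seq I) (F : I -> T -> R) :
  (forall i, square_integrable (F i)) ->
  square_integrable (fun w => \sum_(i <- s) F i w).
Proof.
move=> sF; elim: s => [|i s IHs].
  by under eq_fun do rewrite big_nil; exact: square_integrable_cst.
by under eq_fun do rewrite big_cons; exact: square_integrableD.
Qed.

Lemma Rintegral_sum (I : Type) (s : seq I) (F : I -> T -> R) :
  (forall i, P.-integrable setT (EFin \o F i)) ->
  \int[P]_w (\sum_(i <- s) F i w) = \sum_(i <- s) \int[P]_w F i w.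
Proof.
move=> iF; elim: s => [|i s IHs].
  under eq_Rintegral do rewrite big_nil.
  by rewrite Rintegral_cst// mul0r big_nil.
under eq_Rintegral do rewrite big_cons.
rewrite big_cons -IHs RintegralD//.
have := integrable_sum measurableT s (fun i (_ : true) => iF i).
by apply: eq_integrable => // w _ /=; rewrite sumEFin.
Qed.

Lemma Rintegral_mul_affine k (Z : 'I_k -> T -> R) g (a : 'I_k -> R) (b : R) :
  (forall l, square_integrable (Z l)) -> square_integrable g ->
  \int[P]_w (g w * (\sum_l a l * Z l w + b)) =
  \sum_l a l * (\int[P]_w (Z l w * g w)) + b * \int[P]_w g w.
Proof.
move=> sZ sg; have ig := square_integrable_integrable sg.
have iZg l := square_integrableM (sZ l) sg.
have iaZ l : P.-integrable setT (EFin \o (fun w => a l * (Z l w * g w))).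
  exact: (integrableZl measurableT (a l) (iZg l)).
transitivity (\int[P]_w (\sum_l a l * (Z l w * g w) + b * g w)).
  apply: eq_Rintegral => w _; rewrite mulrDr mulr_sumr [b * _]mulrC.
  congr (_ + _).
  by apply: eq_bigr => l _; ring.
rewrite RintegralD//; last exact: (integrableZl measurableT b ig).
  rewrite Rintegral_sum// RintegralZl//; congr (_ + _).
  by apply: eq_bigr => l _; rewrite RintegralZl.
have := integrable_sum measurableT (index_enum 'I_k)
  (fun l (_ : true) => iaZ l).
by apply: eq_integrable => // w _ /=; rewrite sumEFin.
Qed.

(** The coefficients cs and ms are those of the orthogonal projection of Y on
    the span of the Z_l and 1: the residual rs is orthogonal to this span, so by
    Pythagoras any other choice adds the square of a norm.  The identities for
    cs and ms are only asked for when Y is square integrable: otherwise the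
    error is infinite for all c and m. *)
Lemma least_squares_orthonormal k (Z : 'I_k -> T -> R) (Y : T -> R)
    (cs : 'I_k -> R) (ms : R) :
  (forall l, square_integrable (Z l)) ->
  (forall l, \int[P]_w Z l w = 0) ->
  (forall l i, \int[P]_w (Z l w * Z i w) = (l == i)%:R) ->
  measurable_fun setT Y ->
  (square_integrable Y -> \int[P]_w Y w = ms) ->
  (square_integrable Y -> forall l, \int[P]_w (Z l w * Y w) = cs l) ->
  forall c m,
  (\int[P]_w ((Y w - \sum_l cs l * Z l w - ms) ^+ 2)%:E <=
   \int[P]_w ((Y w - \sum_l c l * Z l w - m) ^+ 2)%:E)%E.
Proof.
move=> sZ EZ EZZ mY EY EYZ c m.
have sL (c' : 'I_k -> R) (m' : R) :
    square_integrable (fun w => \sum_l c' l * Z l w + m').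
  apply: square_integrableD; last exact: square_integrable_cst.
  by apply: square_integrable_sum => l; exact: square_integrableZ.
pose r w := Y w - \sum_l c l * Z l w - m.
have [->|/eqP r2oo] := pselect ((\int[P]_w (r w ^+ 2)%:E = +oo)%E).
  exact: leey.
have mr : measurable_fun setT r.
  have -> : r = (fun w => Y w - (\sum_l c l * Z l w + m)).
    by apply/funext => w; rewrite /r; ring.
  by apply: measurable_funB => //; case: (sL c m).
have sr : square_integrable r.
  split=> //; apply/integrableP; split.
    by apply/measurable_EFinP; exact: measurable_funX.
  under eq_integral do rewrite /= ger0_norm ?sqr_ge0//.
  by rewrite ltey.
(* A finite error makes Y the sum of two square-integrable functions. *)
have sY : square_integrable Y.
  have := square_integrableD sr (sL c m).
  by congr square_integrable; apply/funext => w; rewrite /r; ring.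
pose rs w := Y w - \sum_l cs l * Z l w - ms.
have srs : square_integrable rs.
  have := square_integrableD sY (square_integrableZ (-1) (sL cs ms)).
  by congr square_integrable; apply/funext => w; rewrite /rs; ring.
pose q w := \sum_l (cs l - c l) * Z l w + (ms - m).
have sq : square_integrable q by exact: sL.
(* The competing residual is the optimal one plus an element of the span. *)
have rE w : r w = rs w + q w.
  rewrite /r /rs /q; under [X in _ + (X + _)]eq_bigr do rewrite mulrBl.
  by rewrite sumrB; ring.
have sYZ l := square_integrableM (sZ l) sY.
have s1 := square_integrable_cst 1.
have E1 f : square_integrable f -> P.-integrable setT (EFin \o f).
  exact: square_integrable_integrable.
have orth1 : \int[P]_w rs w = 0.
  transitivity (\int[P]_w (Y w - 1 * (\sum_l cs l * Z l w + ms))).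
    by apply: eq_Rintegral => w _; rewrite /rs mul1r; ring.
  rewrite RintegralB//; [|exact: E1|exact: square_integrableM].
  rewrite Rintegral_mul_affine// EY// Rintegral_cst//.
  rewrite [X in fine X](probability_setT P) !mulr1.
  rewrite big1 ?add0r ?subrr// => l _.
  by under eq_Rintegral do rewrite mulr1; rewrite EZ mulr0.
have orthZ l : \int[P]_w (Z l w * rs w) = 0.
  transitivity (\int[P]_w (Z l w * Y w - Z l w * (\sum_l cs l * Z l w + ms))).
    by apply: eq_Rintegral => w _; rewrite /rs; ring.
  rewrite RintegralB//; last exact: square_integrableM.
  rewrite Rintegral_mul_affine// EYZ// EZ mulr0 addr0.
  rewrite (bigD1 l)//= EZZ eqxx mulr1.
  rewrite big1 ?addr0 ?subrr// => i il.
  by rewrite EZZ (negbTE il) mulr0.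
have orth : \int[P]_w (rs w * q w) = 0.
  rewrite Rintegral_mul_affine// orth1 mulr0 addr0.
  by rewrite big1// => l _; rewrite orthZ mulr0.
have irq := square_integrableM srs sq.
have fin (f : T -> R) : square_integrable f ->
    (\int[P]_w (f w ^+ 2)%:E)%E = (\int[P]_w (f w ^+ 2))%:E.
  by move=> [_ if2]; rewrite fineK//; exact: integrable_fin_num.
rewrite -/(rs _) !fin// lee_fin.
have [_ irs2] := srs; have [_ iq2] := sq.
have -> : \int[P]_w (r w ^+ 2) =
    \int[P]_w (rs w ^+ 2 + q w ^+ 2 + 2 * (rs w * q w)).
  by apply: eq_Rintegral => w _; rewrite rE; ring.
rewrite RintegralD//; [|exact: (integrableD measurableT irs2 iq2)
  |exact: (integrableZl measurableT 2 irq)].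
rewrite RintegralD// RintegralZl// orth mulr0 addr0 lerDl.
by apply: Rintegral_ge0 => w _; exact: sqr_ge0.
Qed.

End square_integrable.

(** * Moments of independent standard normal variables *)

(** From y <= exp y at y = 3 x^2 / 8, the exponent by which the density of
    variance 4 exceeds the standard one. *)
Lemma std_normal_pdf_sqr_le (R : realType) (x : R) :
  x ^+ 2 * normal_pdf 0 1 x <=
  8 / 3 * normal_peak 1 / normal_peak 2 * normal_pdf 0 2 x.
Proof.
rewrite !normal_pdfE ?oner_eq0//= ?pnatr_eq0//.
have p1 : 0 <= normal_peak 1 :> R by exact: normal_peak_ge0.
have p2 : normal_peak 2 != 0 :> R.
  by rewrite gt_eqF// normal_peak_gt0// pnatr_eq0.
have -> : 8 / 3 * normal_peak 1 / normal_peak 2 *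
    (normal_peak 2 * normal_fun 0 2 x) =
  normal_peak 1 * (8 / 3 * normal_fun 0 2 x) by field.
rewrite mulrCA ler_wpM2l//.
have -> : normal_fun 0 2 x = expR (3 / 8 * x ^+ 2) * normal_fun 0 1 x.
  by rewrite /normal_fun -expRD !subr0; congr expR; field.
rewrite mulrA ler_wpM2r ?normal_fun_ge0//.
have := expR_ge1Dx (3 / 8 * x ^+ 2); lra.
Qed.

Lemma std_normal_sqr_integrable (R : realType) :
  (gamma : probability _ R).-integrable setT (fun x => (x ^+ 2)%:E).
Proof.
have msq : measurable_fun setT (fun x : R => (x ^+ 2)%:E).
  by apply/measurable_EFinP; exact: measurable_funX.
apply/integrableP; split => //.
rewrite integral_normal_prob; last exact: measurableT_comp.
pose C : R := 8 / 3 * normal_peak 1 / normal_peak 2.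
have iC := integrableZl measurableT C (integrable_normal_pdf (0 : R) 2).
apply: le_lt_trans (integrable_lty measurableT iC).
apply: ge0_le_integral => //.
- by move=> x _; rewrite mule_ge0// lee_fin normal_pdf_ge0.
- apply: emeasurable_funM; first exact: measurableT_comp.
  by apply/measurable_EFinP; exact: measurable_normal_pdf.
- by case/integrableP : iC.
- move=> x _; rewrite /= ger0_norm ?sqr_ge0// -!EFinM lee_fin.
  exact: std_normal_pdf_sqr_le.
Qed.

Section moments.
Context (R : realType) d (T : measurableType d) (P : probability T R) (k : nat).
Variables (Z : 'I_k -> {RV P >-> R}).
Hypothesis lawZ : forall j (B : set R), measurable B ->
  distribution P (Z j) B = gamma B.
Hypothesis indZ : mutually_independent Z.

Lemma std_normal_square_integrable j : square_integrable P (Z j).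
Proof.
split; first exact: measurable_funPT.
have mX : measurable_fun setT (fun x : R => (x ^+ 2)%:E).
  by apply/measurable_EFinP; exact: measurable_funX.
apply/integrableP; split.
  by apply: (measurableT_comp mX); exact: measurable_funPT.
have /integrableP[_] := std_normal_sqr_integrable R.
have maX : measurable_fun setT (fun x : R => `|(x ^+ 2)%:E|)%E.
  exact: measurableT_comp.
have mZ : measurable_fun setT (Z j) by exact: measurable_funPT.
(* The two measurable structures on R have distinct displays; the measure gamma
   lives on [measurableTypeR R]. *)
pose ZR : {mfun T >-> measurableTypeR R} :=
  MeasurableFun.Pack (MeasurableFun.Class
    (isMeasurableFun.Build _ _ T (measurableTypeR R) (Z j) mZ)).
have <- : (\int[distribution P ZR]_y `|(y ^+ 2)%:E| =
           \int[gamma]_y `|(y ^+ 2)%:E|)%E.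
  by apply: eq_measure_integral => A mA _; exact: lawZ.
by rewrite ge0_integral_distribution.
Qed.

(** Stein's identity for the constant function 1. *)
Lemma std_normal_mean0 j : \int[P]_w Z j w = 0.
Proof.
have iZ := square_integrable_integrable (std_normal_square_integrable j).
pose f (v : 'cV[R]_k) : R := 1; pose a l : 'cV[R]_k := delta_mx l 0.
have sf : differentiable_selection f.
  apply: differentiable_selection_differentiable => x.
  exact: differentiable_cst.
have Df x : upper_derivative f (a j) x = 0.
  by apply: upper_derivative_affine => t; rewrite subrr mulr0.
have ic (c : R) : P.-integrable setT (fun=> c%:E).
  exact: (finite_measure_integrable_cst P c).
transitivity (\int[P]_w (Z j w * f (0 + \sum_l Z l w *: a l))).
  by apply: eq_Rintegral => w _; rewrite mulr1.
rewrite stein_gaussian//.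
- under eq_Rintegral do rewrite Df.
  by rewrite Rintegral_cst// mul0r.
- exact: ic.
- by apply: eq_integrable iZ => // w _ /=; rewrite mulr1.
- by under eq_fun do rewrite Df; exact: ic.
Qed.

(** Stein's identity for the i-th coordinate function, whose derivative in the
    direction of the j-th basis vector is the Kronecker symbol. *)
Lemma std_normal_covariance j i : \int[P]_w (Z j w * Z i w) = (j == i)%:R.
Proof.
have sZ := std_normal_square_integrable.
have iZ := square_integrable_integrable (sZ i).
have iZZ := square_integrableM (sZ j) (sZ i).
pose f (v : 'cV[R]_k) : R := v i 0; pose a l : 'cV[R]_k := delta_mx l 0.
have sf : differentiable_selection f.
  apply: differentiable_selection_differentiable => x.
  exact: differentiable_coord.
have Df x : upper_derivative f (a j) x = (j == i)%:R.
  apply: upper_derivative_affine => t; rewrite /f !mxE addrK; congr (_ * _).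
  by rewrite eqxx andbT eq_sym.
have fV w : f (0 + \sum_l Z l w *: a l) = Z i w.
  rewrite /f add0r summxE (bigD1 i)//= !mxE !eqxx mulr1 big1 ?addr0// => l li.
  by rewrite !mxE eq_sym (negbTE li) mulr0.
have ic (c : R) : P.-integrable setT (fun=> c%:E).
  exact: (finite_measure_integrable_cst P c).
transitivity (\int[P]_w (Z j w * f (0 + \sum_l Z l w *: a l))).
  by apply: eq_Rintegral => w _; rewrite fV.
rewrite stein_gaussian//.
- under eq_Rintegral do rewrite Df.
  by rewrite Rintegral_cst// [X in fine X](probability_setT P) mulr1.
- by under eq_fun do rewrite fV.
- by under eq_fun do rewrite fV.
- by under eq_fun do rewrite Df; exact: ic.
Qed.

End moments.

(** * The quasilinear gain minimizes the error *)

Lemma ae_eq_integrable (R : realType) d (T : measurableType d)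
    (P : {measure set T -> \bar R}) (f g : T -> \bar R) :
  measurable_fun setT g -> ae_eq P setT f g -> P.-integrable setT f ->
  P.-integrable setT g.
Proof.
move=> mg fg /integrableP[mf foo]; apply/integrableP; split => //.
suff <- : (\int[P]_w `|f w| = \int[P]_w `|g w|)%E by [].
have FF := ae_filter_ringOfSetsType P.
apply: ae_eq_integral => //; try exact: measurableT_comp.
by apply: filterS fg => w fgw /fgw ->.
Qed.

Lemma upper_derivative_gradient (R : realType) n (f : 'cV[R]_n -> R)
    (a x : 'cV[R]_n) :
  differentiable f x ->
  upper_derivative f a x = \sum_i a i 0 * gradient f x i 0.
Proof.
move=> dx; rewrite upper_derivativeE; last exact: diff_derivable.
rewrite deriveE// {1}(matrix_sum_delta a) exchange_big big_ord1 linear_sum.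
by apply: eq_bigr => i _; rewrite linearZ /= mxE deriveE.
Qed.

Lemma measurable_quasilinear_residual (R : realType) d (T : measurableType d) n
    (f : 'cV[R]_n -> R) (N c : 'cV[R]_n) (M : R) (V : T -> 'cV[R]_n) :
  continuous f -> (forall i, measurable_fun setT (fun w => V w i 0)) ->
  measurable_fun setT (fun w => f (V w) - (N^T *m (V w - c)) 0 0 - M).
Proof.
move=> cf mV; apply: measurable_funB => //.
apply: measurable_funB; first exact: measurable_continuous_col cf mV.
under eq_fun do rewrite mxE.
apply: measurable_sum => i; under eq_fun do rewrite !mxE.
by apply: measurable_funM => //; exact: measurable_funB.
Qed.

Theorem theorem1 (R : realType) (d : measure_display) (T : measurableType d)
    (P : probability T R) (n : nat) (u : 'I_n -> R -> {RV P >-> R})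
    (mu : R -> 'cV[R]_n)
    (hwss : forall i, wide_sense_stationary (u i))
    (hgauss : jointly_gaussian u)
    (hmu : forall i t, ('E_P[u i t] = (mu t i 0)%:E)%E)
    (f : 'cV[R]_n -> R) (hf : piecewise_differentiable f) (t : R) :
  let U := random_col (fun i => u i t) in
  let U0 := fun w => U w - mu t in
  has_mean_gradient P f U ->
  forall (N : 'cV[R]_n) (M : R),
    (quasilinear_error P f U U0
       (mean_col P (fun w => gradient f (U w))) (mean P (fun w => f (U w)))
     <= quasilinear_error P f U U0 N M)%E.
Proof.
move=> U U0 [dfU igrad] N M.
(* One instant is enough: the vector u(t) is Gaussian. *)
have [k [Z [b [A [lawZ indZ UE]]]]] := hgauss 1%N (fun=> t).
have FF := ae_filter_ringOfSetsType P.
have sf : differentiable_selection f := hf.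
have sZ := std_normal_square_integrable lawZ.
have mU i : measurable_fun setT (fun w => U w i 0).
  by under eq_fun do rewrite mxE; exact: measurable_funPT.
pose bc : 'cV[R]_n := \col_i b (i, ord0).
pose a l : 'cV[R]_n := \col_i A (i, ord0) l.
pose V w := bc + \sum_l Z l w *: a l.
have VE w i : V w i 0 = \sum_l a l i 0 * Z l w + b (i, ord0).
  rewrite !mxE summxE addrC; congr (_ + _).
  by apply: eq_bigr => l _; rewrite !mxE mulrC.
have mV i : measurable_fun setT (fun w => V w i 0).
  under eq_fun do rewrite VE.
  apply: measurable_funD => //; apply: measurable_sum => l.
  by apply: measurable_funM => //; exact: measurable_funPT.
have UV : {ae P, forall w, U w = V w}.
  apply: filterS UE => w Uw; apply/colP => i.
  rewrite VE mxE (Uw (i, ord0)) addrC; congr (_ + _).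
  by apply: eq_bigr => l _; rewrite !mxE.
have E1 (g : T -> R) : \int[P]_w (1 * g w) = \int[P]_w g w.
  by apply: eq_Rintegral => w _; rewrite mul1r.
have sV i : square_integrable P (fun w => V w i 0).
  under eq_fun do rewrite VE.
  apply: square_integrableD; last exact: square_integrable_cst.
  by apply: square_integrable_sum => l; exact: square_integrableZ.
have EV i : \int[P]_w V w i 0 = b (i, ord0).
  under eq_Rintegral do rewrite VE.
  rewrite -E1 Rintegral_mul_affine//; last exact: square_integrable_cst.
  rewrite Rintegral_cst// [X in fine X](probability_setT P) !mulr1.
  rewrite big1 ?add0r// => l _.
  under eq_Rintegral do rewrite mulr1.
  by rewrite (std_normal_mean0 lawZ indZ) mulr0.
have mub : mu t = bc.
  apply/colP => i; apply/EFin_inj; rewrite -hmu unlock mxE -EV.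
  rewrite /Rintegral fineK; last first.
    exact: integrable_fin_num (square_integrable_integrable (sV i)).
  apply: ae_eq_integral => //.
  - by apply/measurable_EFinP; exact: measurable_funPT.
  - exact/measurable_EFinP.
  - by apply: filterS UV => w UVw _; rewrite -UVw mxE.
have mY : measurable_fun setT (fun w => f (V w)).
  exact: measurable_continuous_col sf.1 mV.
(* The coefficients of N^T u0(t) along the Z_l. *)
pose c (N : 'cV[R]_n) l := \sum_i N i 0 * a l i 0.
have resE N' w : (N'^T *m (V w - bc)) 0 0 = \sum_l c N' l * Z l w.
  rewrite /V addrC addKr mulmx_sumr summxE; apply: eq_bigr => l _.
  rewrite -scalemxAr mxE mulrC; congr (_ * _).
  by rewrite mxE; apply: eq_bigr => i _; rewrite mxE.
have errE N' M' : quasilinear_error P f U U0 N' M' =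
    (\int[P]_w ((f (V w) - \sum_l c N' l * Z l w - M') ^+ 2)%:E)%E.
  rewrite /quasilinear_error unlock; apply: ae_eq_integral => //.
  - apply/measurable_EFinP/measurable_funX.
    exact: measurable_quasilinear_residual sf.1 mU.
  - apply/measurable_EFinP/measurable_funX.
    under eq_fun do rewrite -resE.
    exact: measurable_quasilinear_residual sf.1 mV.
  - by apply: filterS UV => w UVw _ /=; rewrite /U0 UVw mub resE.
rewrite !errE.
apply: least_squares_orthonormal => //.
- exact: std_normal_mean0.
- exact: std_normal_covariance.
- move=> sY; rewrite /mean unlock; congr fine; apply: ae_eq_integral => //.
  + exact/measurable_EFinP.
  + by apply/measurable_EFinP; exact: measurable_continuous_col sf.1 mU.
  + by apply: filterS UV => w UVw _; rewrite UVw.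
move=> sY l.
have igr i : P.-integrable setT (fun w => (a l i 0 * gradient f (U w) i 0)%:E).
  exact: (integrableZl measurableT (a l i 0) (igrad i)).
have igrs : P.-integrable setT
    (fun w => (\sum_i a l i 0 * gradient f (U w) i 0)%:E).
  have := integrable_sum measurableT (index_enum 'I_n)
    (fun i (_ : true) => igr i).
  by apply: eq_integrable => // w _ /=; rewrite sumEFin.
have mD := measurable_upper_derivative_col (a l) sf.1 mV.
have aeD : ae_eq P setT (fun w => (\sum_i a l i 0 * gradient f (U w) i 0)%:E)
    (fun w => (upper_derivative f (a l) (V w))%:E).
  apply: filterS2 UV dfU => w UVw dw _.
  by rewrite -UVw upper_derivative_gradient.
have iD : P.-integrable setT (fun w => (upper_derivative f (a l) (V w))%:E).
  by apply: ae_eq_integrable aeD igrs; exact/measurable_EFinP.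
rewrite (stein_gaussian lawZ indZ)//; last 2 first.
- exact: square_integrable_integrable sY.
- exact: square_integrableM (sZ l) sY.
transitivity (\int[P]_w \sum_i a l i 0 * gradient f (U w) i 0).
  congr fine; apply/esym; apply: ae_eq_integral aeD => //.
  - by case/integrableP : igrs.
  - exact/measurable_EFinP.
rewrite Rintegral_sum//; apply: eq_bigr => i _.
rewrite RintegralZl//; last exact: igrad.
have -> : mean_col P (fun w => gradient f (U w)) i 0 =
    \int[P]_w gradient f (U w) i 0 by rewrite mxE /mean unlock.
exact: mulrC.
Qed.
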